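(* For any $A\subset\mathbb{Z}_+$ and $\epsilon>0$, $$\lim_{n\to\infty}Q_n\left(\left|\hat\mu_n(A)-\mu_\infty(A)\right|>\epsilon\right)=0.$$
   Context: $\mathbb{Z}_+=\{0,1,\dots\}$. Fix $L\in\mathbb{N}$ and $c_1,\dots,c_L\in\mathbb{Z}_+$ with $c_1c_L>0$ and $(L,c_1)\ne(1,1)$. The positive linear recursion $(G_n)_{n\ge1}$ is: $G_1=1$; $G_{n+1}=c_1G_n+c_2G_{n-1}+\dots+c_nG_1+1$ for $1\le n\le L-1$; $G_{n+1}=\sum_{j=1}^Lc_jG_{n+1-j}$ for $n\ge L$. An expression $N=\sum_{i=1}^na_iG_{n+1-i}$ with $a_1\in\mathbb{N}$, $a_2,\dots,a_n\in\mathbb{Z}_+$ is a legal decomposition of length $n$ if either (i) $n<L$ and $a_i=c_i$ for $1\le i\le n$; or (ii) there is $s\in\{1,\dots,L\}$ with $a_1=c_1,\dots,a_{s-1}=c_{s-1}$, $a_s<c_s$, $a_{s+1}=\dots=a_{s+\ell}=0$ for some $\ell\ge0$, and $(a_{s+\ell+i})_{i=1}^{n-s-\ell}$ is either (the digit sequence of) a legal decomposition or empty. It is known that every positive integer has a unique legal decomposition, and the integers in $[G_n,G_{n+1})$ are exactly those whose legal decomposition has length $n$. $Q_n$ ($n\in\mathbb{Z}_+$) denotes the uniform distribution on the integers $N\in[G_{n+1},G_{n+2})$, with expectation $E^{Q_n}$; the legal decomposition of such $N$ is written $N=\sum_{j=0}^nX_jG_{n+1-j}$. Gaps: a digit $X_j>0$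 contributes $X_j-1$ gaps of length $0$, and, if there is a later nonzero digit, one gap of length $\min\{k\ge1:X_{j+k}>0\}$. $N_n(k)$ denotes the number of gaps of length $k$: $N_n(0)=\sum_{j=0}^{n-1}\max(X_j-1,0)$ and, for $k\ge1$, $N_n(k)=\#\{0\le j\le n-k:X_j>0,\ X_{j+1}=\dots=X_{j+k-1}=0,\ X_{j+k}>0\}$. $N_n=\sum_{k\ge0}N_n(k)$. The empirical gap distribution is the random measure on $\mathbb{Z}_+$ $$\hat\mu_n(A)=\frac{\sum_{k\in A}N_n(k)}{\max(N_n,1)}.$$ $\mu_\infty$ is the probability measure on $\mathbb{Z}_+$ given by $\mu_\infty(k)=\lim_{n\to\infty}\frac{E^{Q_n}N_n(k)}{E^{Q_n}N_n}$ (these limits exist and sum to $1$). *)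

(* Defs.v *)
From mathcomp Require Import all_boot all_order all_algebra.
From mathcomp Require Import all_classical all_reals all_analysis.
Set Implicit Arguments.
Unset Strict Implicit.
Unset Printing Implicit Defensive.
Import Order.TTheory GRing.Theory Num.Theory.
Import numFieldNormedType.Exports.

Local Open Scope nat_scope.

(* The coefficients c_1, ..., c_L are the values c 1, ..., c L of a function
   c : nat -> nat; its other values are never used. *)

(* The terms [:: G_n; ...; G_1]. *)
Fixpoint plr_seq (L : nat) (c : nat -> nat) (n : nat) : seq nat :=
  if n is m.+1 then
    let s := plr_seq L c m in
    \sum_(1 <= j < (minn m L).+1) c j * nth 0 s j.-1 + (m < L) :: s
  else [::].

(* The positive linear recursion, indexed from 1; plr L c 0 is a junk value.
   The defining equations are plr1, plr_small and plr_large below. *)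
Definition plr (L : nat) (c : nat -> nat) (n : nat) : nat :=
  head 0 (plr_seq L c n).

Lemma nth_plr_seq L c n j : j < n -> nth 0 (plr_seq L c n) j = plr L c (n - j).
Proof.
elim: n j => [//|n IHn] [|j] //= ltjn; exact: IHn.
Qed.

Lemma plrS L c n :
  plr L c n.+1 =
  \sum_(1 <= j < (minn n L).+1) c j * plr L c (n.+1 - j) + (n < L).
Proof.
rewrite {1}/plr /=; congr (_ + _); apply: eq_big_nat => -[//|j].
rewrite !ltnS => /andP[_ ltj]; rewrite nth_plr_seq ?subSS //.
by apply: leq_trans ltj _; apply: geq_minl.
Qed.

Lemma plr1 L c : 0 < L -> plr L c 1 = 1.
Proof. by move=> L_gt0; rewrite plrS min0n big_geq // L_gt0. Qed.

Lemma plr_small L c n : 1 <= n <= L.-1 ->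
  plr L c n.+1 = \sum_(1 <= j < n.+1) c j * plr L c (n.+1 - j) + 1.
Proof.
case: L => [|L] /= /andP[n_gt0 leL]; first by case: n n_gt0 leL.
by rewrite plrS ltnS leL (minn_idPl _) // leqW.
Qed.

Lemma plr_large L c n : L <= n ->
  plr L c n.+1 = \sum_(1 <= j < L.+1) c j * plr L c (n.+1 - j).
Proof. by move=> leLn; rewrite plrS (minn_idPr leLn) ltnNge leLn addn0. Qed.

(* legal L c [:: a_1; ...; a_n]: the two alternatives for the tail in (ii),
   empty or legal, are the constructors legal_end and legal_cat. *)
Inductive legal (L : nat) (c : nat -> nat) : seq nat -> Prop :=
| legal_short n :
    0 < n < L -> 0 < c 1 ->
    legal L c [seq c i | i <- iota 1 n]
| legal_end s x l :
    1 <= s <= L -> x < c s ->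
    let a := rcons [seq c i | i <- iota 1 s.-1] x in
    0 < head 0 a ->
    legal L c (a ++ nseq l 0)
| legal_cat s x l b :
    1 <= s <= L -> x < c s ->
    let a := rcons [seq c i | i <- iota 1 s.-1] x in
    0 < head 0 a ->
    legal L c b ->
    legal L c (a ++ nseq l 0 ++ b).

Definition decomp_value (L : nat) (c : nat -> nat) (a : seq nat) : nat :=
  \sum_(0 <= i < size a) nth 0 a i * plr L c (size a - i).

(* The legal decomposition of N; it exists and is unique for 0 < N, and the
   default value [::] is taken otherwise. *)
Definition decomp (L : nat) (c : nat -> nat) (N : nat) : seq nat :=
  xget [::] [set a | legal L c a /\ decomp_value L c a = N]%classic.

(* X_j for N in [G_{n+1}, G_{n+2}[, whose decomposition has digits X_0..X_n. *)
Definition digit (L : nat) (c : nat -> nat) (N j : nat) : nat :=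
  nth 0 (decomp L c N) j.

(* N_n(k) as a function of the digits X. The truncated predecessor in the
   case k = 0 is max(X_j - 1, 0). *)
Definition gap_count (n k : nat) (X : nat -> nat) : nat :=
  if k == 0 then \sum_(0 <= j < n) (X j).-1
  else #|[pred j : 'I_n.+1 |
            [&& j + k <= n, 0 < X j,
                [forall i : 'I_k, (0 < i) ==> (X (j + i) == 0)]
              & 0 < X (j + k)]]|.

(* There is no gap of length k > n, so that the sums over k may be truncated
   at n. *)
Lemma gap_count_gt n k X : n < k -> gap_count n k X = 0.
Proof.
case: k => // k ltnk; rewrite /gap_count /=; apply: eq_card0 => j.
by rewrite !inE leqNgt (leq_trans ltnk) ?leq_addl.
Qed.

Definition gap_total (n : nat) (X : nat -> nat) : nat :=
  \sum_(0 <= k < n.+1) gap_count n k X.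

Local Open Scope ring_scope.
Local Open Scope classical_set_scope.

Definition hat_mu (R : realType) (n : nat) (X : nat -> nat) (A : set nat) : R :=
  (\sum_(0 <= k < n.+1 | k \in A) gap_count n k X)%N%:R
    / (maxn (gap_total n X) 1)%:R.

(* Expectation and probability under Q_n, uniform on [G_{n+1}, G_{n+2}[. *)
Definition EQ (R : realType) (L : nat) (c : nat -> nat) (n : nat)
    (f : nat -> R) : R :=
  (\sum_(plr L c n.+1 <= N < plr L c n.+2) f N)
    / (plr L c n.+2 - plr L c n.+1)%N%:R.

Definition Q (R : realType) (L : nat) (c : nat -> nat) (n : nat)
    (P : pred nat) : R :=
  EQ L c n (fun N => (P N)%:R).

Definition mu_infty1 (R : realType) (L : nat) (c : nat -> nat) (k : nat) : R :=
  lim ((EQ L c n (fun N => (gap_count n k (digit L c N))%:R)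
          / EQ L c n (fun N => (gap_total n (digit L c N))%:R) : R)
        @[n --> \oo]).

Definition mu_infty (R : realType) (L : nat) (c : nat -> nat) (A : set nat) : R :=
  lim ((\sum_(0 <= k < m | k \in A) mu_infty1 R L c k) @[m --> \oo]).

(* Main.v *)
Require Import Defs.
From mathcomp Require Import all_boot all_order all_algebra.
From mathcomp Require Import zify ring lra.
From mathcomp Require Import all_classical all_reals all_analysis.
Set Implicit Arguments.
Unset Strict Implicit.
Unset Printing Implicit Defensive.
Import Order.TTheory GRing.Theory Num.Theory.
Import numFieldNormedType.Exports.
Local Open Scope ring_scope.
Local Open Scope classical_set_scope.

(** Legal decompositions, with zeros in front, are the words of an automaton.  Its
    state [s < L] records that the last [s] digits were [c_1, ..., c_s]: reading
    a digit [x < c_(s+1)] closes a block and leads back to state 0, reading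
    [c_(s+1)] leads to state [s+1].  The words of length [n] read from state 0,
    in lexicographic order, have the values [0, ..., G_(n+1) - 1]
    ([value_words]), and those with nonzero first digit are the legal
    decompositions ([legal_readable], [readable_legal]).  So [Q_n] is the uniform
    law on the words of length [n+1] that do not start with 0 ([decomp_words]).

    The number of gaps of a given length is quasi-additive: cutting a word in two
    changes it by a bounded amount ([gaps_cat]).  Every quasi-additive statistic
    [S] obeys a law of large numbers, for three reasons.

    - From any two states the mean of [S] over the words of length [m] is the
      same up to a constant independent of [m] ([avg_spread]): in [L] steps every
      state reaches 0 with probability bounded below, which contracts the
      differences.  So revealing one more digit moves the conditional mean of [S]
      by a bounded amount, and the variance of [S] grows at most linearly
      ([variance_linear]).
    - The law of the first [m] digits of a longer word has a bounded density with
      respect to the uniform law on the words of length [m]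
      ([nwords_comparable]), so the deviation bound holds for it too, and the mean
      of [S] is additive up to an error [o(m)] ([near_additive]).  Then the mean
      divided by [m] converges ([near_additive_cvg]).
    - [Q_n] also has a bounded density ([EQ_le_avg]), so [S / (n+1)] converges in
      mean to the same limit ([law_of_large_numbers]).

    Apply this to the number of gaps of length [k], with limit [a k].  A gap of
    length [k] takes up [k] places, so at most [(n+1)/K] gaps are of length [K] or
    more ([gaps_tail]); no mass escapes and the number of gaps with length in [A],
    divided by [n+1], converges in mean to the sum of the [a k] over [A]
    ([EQ_cvg_gaps]).  The total density is positive since on average a positive
    proportion of the digits is nonzero ([gap_density_pos]).  Dividing the limits gives
    the empirical distribution and identifies its limit as [mu_infty]; Markov's
    inequality ends the proof. *)

(** * Nearly additive sequences *)

(** The error [eta * m + K] is charged to the first summand alone, so cutting [n]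
    into blocks of one large length [m] costs at most [2 * eta * m] per block,
    that is [2 * eta * n] in all. *)
Lemma near_additive_cvg (R : realType) (v : nat -> R) :
  (forall eta, 0 < eta -> exists2 K, 0 <= K & forall m l,
     `|v (m + l)%N - v m - v l| <= eta * m%:R + K) ->
  cvg ((v m / m%:R) @[m --> \oo]).
Proof.
move=> v_add; apply: cauchy_cvg; apply: cauchy_exP => e e0.
have e4 : 0 < e / 4 by rewrite divr_gt0.
have [K K_ge0 vK] := v_add _ e4; set eta := e / 4 in e4 vK.
have [m [m0 Km]] : exists m, (0 < m)%N /\ K <= eta * m%:R.
  have : \forall m \near \oo, (0 < m)%N /\ K <= eta * m%:R.
    near=> m; split; first by near: m; exact: nbhs_infty_gt.
    rewrite mulrC -ler_pdivrMr // ltW //; near: m; exact: nbhs_infty_gtr.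
  by move=> /filter_ex[m mP]; exists m.
have mR : 0 < m%:R :> R by rewrite ltr0n.
have blocks q r : `|v (q * m + r)%N - q%:R * v m - v r| <= q%:R * (2 * eta * m%:R).
  elim: q => [|q IHq]; first by rewrite mul0n add0n !mul0r subr0 subrr normr0.
  have := vK m (q * m + r)%N; move: IHq.
  rewrite mulSn addnA -[in q.+1%:R]addn1 natrD !ler_norml; lra.
(* the contribution of the incomplete last block *)
pose D := \sum_(r < m) `|v r| + `|v m| : R.
exists (v m / m%:R).
suff : \forall n \near \oo, ball (v m / m%:R) e (v n / n%:R) by [].
near=> n; rewrite -ball_normE /=.
have n0 : 0 < n%:R :> R by rewrite ltr0n; near: n; exact: nbhs_infty_gt.
have Dn : D <= eta * n%:R.
  rewrite mulrC -ler_pdivrMr // ltW //; near: n; exact: nbhs_infty_gtr.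
have := blocks (n %/ m)%N (n %% m)%N; rewrite -divn_eq.
have rm := ltn_pmod n m0.
have rD : `|v (n %% m)%N| + `|v m| <= D.
  by rewrite lerD2r (bigD1 (Ordinal rm)) //= lerDl sumr_ge0.
have rR : (n %% m)%:R <= m%:R :> R by rewrite ler_nat ltnW.
have r0 : 0 <= (n %% m)%:R :> R by [].
have q0 : 0 <= (n %/ m)%:R :> R by [].
have : n%:R = (n %/ m)%:R * m%:R + (n %% m)%:R :> R.
  by rewrite -natrM -natrD -divn_eq.
move: ((n %/ m)%:R) q0 ((n %% m)%:R) (v (n %% m)%N) r0 rR rD => q q0 r w r0 rR rD nE.
move=> dev.
have rv : `|r * (v m / m%:R)| <= `|v m|.
  rewrite mulrA [r * _]mulrC -mulrA normrM ler_piMr // ger0_norm ?divr_ge0 //.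
  by rewrite ler_pdivrMr // mul1r.
rewrite -(ltr_pM2r n0) -[X in _ * X < _]gtr0_norm // -normrM mulrBl divfK ?gt_eqF //.
have -> : v m / m%:R * n%:R - v n = r * (v m / m%:R) - w - (v n - q * v m - w).
  by rewrite nE; field; rewrite gt_eqF.
have qn : q * (2 * eta * m%:R) <= 2 * eta * n%:R.
  rewrite nE mulrDr [X in _ <= X + _](_ : _ = q * (2 * eta * m%:R)); last by ring.
  by rewrite lerDl !mulr_ge0 // ltW.
have eE : e = 4 * eta by rewrite /eta; field.
have en : 0 < eta * n%:R by rewrite mulr_gt0.
apply: le_lt_trans (ler_normB _ _) _.
have := ler_normB (r * (v m / m%:R)) w; rewrite eE; lra.
Unshelve. all: by end_near. Qed.

(** * Gaps of a word *)

Section Gaps.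
Local Open Scope nat_scope.

Variable b : nat.

Notation pos := (fun x => 0 < x).

(** The gaps that start at the digit [x] of [x :: w].  The last digit of a word
    is left out for [k = 0], as in [N_n(0)].  Truncating the digits at [b] makes
    the statistic bounded on all words, not only on those whose digits are at
    most [b]; it changes nothing on the latter. *)
Definition head_gaps k x w :=
  if k == 0 then if w is [::] then 0 else (minn x b).-1
  else (0 < x) && has pos w && (k == (find pos w).+1) : nat.

Fixpoint gaps k w := if w is x :: w' then head_gaps k x w' + gaps k w' else 0.

Lemma head_gaps_le k x w : head_gaps k x w <= b.+1.
Proof.
rewrite /head_gaps; case: ifP => _; last by case: (_ && _).
by case: w => // _ _; have := geq_minr x b; lia.
Qed.

Lemma head_gaps_cat_le k x p q : head_gaps k x p <= head_gaps k x (p ++ q).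
Proof.
rewrite /head_gaps; case: ifP => [_|k0]; first by case: p.
rewrite has_cat find_cat; case: (boolP (has pos p)) => //=.
by rewrite andbF.
Qed.

Lemma head_gaps_cat_eq k x p q : k < size p ->
  head_gaps k x (p ++ q) = head_gaps k x p.
Proof.
rewrite /head_gaps; case: ifP => [_|k0 kp]; first by case: p.
rewrite has_cat find_cat; case: (boolP (has pos p)) => //= _.
by rewrite andbF andFb [k == _](_ : _ = false) ?andbF //; lia.
Qed.

(** The gaps that start at a digit of [p] are decided by the [k + 1] digits after
    it, so only the last [k + 1] digits of [p] notice that [q] follows. *)
Lemma gaps_cat k p q :
  gaps k p + gaps k q <= gaps k (p ++ q)
    <= gaps k p + gaps k q + b.+1 * minn (size p) k.+1.
Proof.
elim: p => [|x p IHp] /=; first by rewrite min0n muln0 addn0 leqnn.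
have := head_gaps_le k x (p ++ q); have := head_gaps_cat_le k x p q.
have := @head_gaps_cat_eq k x p q.
have [pk _ h1 h2|pk h _ _] := leqP (size p) k.
  rewrite minnSS; move: IHp; rewrite !(minn_idPl _) ?mulnS //; lia.
rewrite h //; move: IHp; rewrite !(minn_idPr _) //; [lia | exact: ltnW].
Qed.

(** A nonzero digit followed by another one starts exactly one gap of positive
    length. *)
Lemma sum_head_gaps M x w : size w <= M ->
  \sum_(1 <= k < M.+1) head_gaps k x w = (0 < x) && has pos w.
Proof.
move=> wM; rewrite big_nat; under eq_bigr => k /andP[k0 _].
  rewrite /head_gaps eqn0Ngt k0 /=; over.
case: andP => [[x0 hw]|_] /=; last by rewrite big1.
rewrite -big_nat (big_rem (find pos w).+1) /=; last first.
  by rewrite mem_index_iota /= ltnS (leq_trans _ wM) // -has_find.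
rewrite eqxx big_seq big1 // => k.
rewrite mem_rem_uniq ?iota_uniq // inE => /andP[/negbTE -> //].
Qed.

(** The gaps of positive length are disjoint intervals of places; the first
    one starts at the first nonzero digit, which leaves room for the leading
    zeros. *)
Lemma sum_gap_lengths M w :
  \sum_(1 <= k < M) k * gaps k w + find pos w <= size w.
Proof.
elim: w => [|x w IHw] /=; first by rewrite big1 //= => k _; rewrite muln0.
under eq_bigr do rewrite mulnDr.
rewrite big_split /=.
suff : \sum_(1 <= k < M) k * head_gaps k x w
    + (if 0 < x then 0 else (find pos w).+1) <= (find pos w).+1 by lia.
case: (posnP x) => [->|x0].
  rewrite big_nat big1 // => k /andP[k0 _].
  by rewrite /head_gaps eqn0Ngt k0 muln0.
rewrite addn0.
apply: (@leq_trans (\sum_(1 <= k < M) (k == (find pos w).+1) * (find pos w).+1)).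
  rewrite !big_nat; apply: leq_sum => k /andP[k0 _].
  rewrite /head_gaps eqn0Ngt k0 x0 /=; case: eqP => [->|_]; last by rewrite andbF muln0.
  by rewrite mul1n; case: (has _ _); rewrite ?muln1 ?muln0.
rewrite -big_distrl /= -[leqRHS]mul1n leq_mul2r; apply/orP; right.
elim: M {IHw} => [|M IHM]; first by rewrite big_geq.
case: M IHM => [|M] IHM; first by rewrite big_geq.
rewrite big_nat_recr //=; case: eqP => [eM|_]; last by rewrite addn0.
by rewrite big_nat big1 // => k; rewrite -eM; lia.
Qed.

Lemma gaps_tail K M (P : pred nat) w : 0 < K ->
  K * (\sum_(K <= k < M | P k) gaps k w) <= size w.
Proof.
move=> K0; apply: leq_trans (leq_trans (leq_addr _ _) (sum_gap_lengths M w)).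
have [KM|MK] := leqP K M; last by rewrite big_geq ?muln0 // ltnW.
rewrite [leqRHS](big_cat_nat (n := K)) //= big_distrr /=; apply: leq_trans (leq_addl _ _).
rewrite big_mkcond !big_nat; apply: leq_sum => k /andP[Kk _].
by case: (P k) => //; rewrite leq_mul2r Kk orbT.
Qed.

(** Every nonzero digit but the last one starts a gap of positive length. *)
Lemma count_pos_le_gaps M w : size w <= M ->
  count pos w <= (\sum_(1 <= k < M.+1) gaps k w).+1.
Proof.
elim: w => [//|x w IHw] /= wM; rewrite big_split /= sum_head_gaps ?(ltnW wM) //.
have := IHw (ltnW wM); case: (boolP (has pos w)) => hw; first by rewrite andbT; lia.
have -> : count pos w = 0 by apply/eqP; rewrite -leqn0 leqNgt -has_count.
by case: (0 < x).
Qed.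

Lemma gap_count_gaps n k w : size w = n.+1 -> all (fun x => x <= b) w ->
  gap_count n k (nth 0 w) = gaps k w.
Proof.
rewrite /gap_count; case: k => [|k] /=.
  elim: w n => // x [|y w] IHw n /= [<-] /andP[xb wb].
    by rewrite big_geq.
  rewrite big_nat_recl //=; congr (_ + _); last exact: IHw.
  by rewrite /head_gaps /= (minn_idPl xb).
move=> sw _; pose P w j := [&& j + k.+1 < size w, 0 < nth 0 w j,
  [forall i : 'I_k.+1, (0 < i) ==> (nth 0 w (j + i) == 0)] &
  0 < nth 0 w (j + k.+1)].
transitivity (\sum_(j < size w) P w j).
  rewrite sw -sum1_card big_mkcond /=; apply: eq_bigr => j _.
  by rewrite unfold_in /= /P sw ltnS; case: ifP.
elim: w {sw n} => [|x w IHw] /=; first by rewrite big_ord0.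
rewrite big_ord_recl /=; congr (_ + _); last first.
  by rewrite -IHw; apply: eq_bigr => j _; rewrite /P /= /bump /= add1n.
rewrite /head_gaps /= /P /= add0n ltnS; congr nat_of_bool.
case: (0 < x); rewrite ?andbF //= ?andTb.
case: findP => [/hasPn hw|i iw /(_ 0) hi hj].
  apply/negbTE/negP => /and3P[kw _].
  by apply/negP; apply: hw; rewrite mem_nth.
rewrite eqSS; have hw : has pos w by apply/(has_nthP 0); exists i.
rewrite andTb; apply/and3P/eqP => [[kw /forallP h hk]|->].
  case: (ltngtP k i) => // ki; first by move: hk; rewrite hj.
  have ik : i.+1 < k.+1 by [].
  have := h (Ordinal ik); rewrite /= => /eqP hi0.
  by move: hi; rewrite hi0.
split=> //; apply/forallP => -[[|j] jk] //=;
by have := hj 0 j jk; lia.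
Qed.

End Gaps.

(** * Legal decompositions as words of an automaton *)

Section PositiveLinearRecursion.

Variables (L : nat) (c : nat -> nat).
Hypotheses (L_gt0 : (0 < L)%N) (c1_gt0 : (0 < c 1%N)%N) (cL_gt0 : (0 < c L)%N).

Section Words.
Local Open Scope nat_scope.

(** In state [s] the digits below [c s.+1] are allowed, and [c s.+1] itself unless
    it would complete the full block [c_1, ..., c_L], which is never legal. *)
Definition nletters s := c s.+1 + (s.+1 < L).

Definition step s x := if x < c s.+1 then 0 else s.+1.

Definition state s p := foldl step s p.

Fixpoint words m s : seq (seq nat) :=
  if m is m'.+1 then
    [seq x :: w | x <- iota 0 (nletters s), w <- words m' (step s x)]
  else [:: [::]].

Definition nwords m s := size (words m s).

Fixpoint readable s w :=
  if w is x :: w' then (x < nletters s) && readable (step s x) w' else true.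

Lemma step_lt s x : s < L -> x < nletters s -> step s x < L.
Proof. by rewrite /step /nletters => sL xs; case: ifP => //; lia. Qed.

Lemma state_cat s p q : state s (p ++ q) = state (state s p) q.
Proof. exact: foldl_cat. Qed.

Lemma state_lt s p : s < L -> readable s p -> state s p < L.
Proof.
elim: p s => //= x p IHp s sL /andP[xs rp]; apply: IHp => //; exact: step_lt.
Qed.

Lemma readable_cat s p q :
  readable s (p ++ q) = readable s p && readable (state s p) q.
Proof. by elim: p s => //= x p IHp s; rewrite IHp andbA. Qed.

Lemma mem_words m s w : (w \in words m s) = (size w == m) && readable s w.
Proof.
elim: m s w => [|m IHm] s [|x w] /=.
- by rewrite inE.
- by rewrite inE.
- by apply/negbTE/allpairsPdep => -[y [v []]].
- apply/allpairsPdep/idP => [[y [v [ys vm [-> ->]]]]|].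
    by move: vm ys; rewrite IHm mem_iota /= => /andP[/eqP-> ->] ->; rewrite eqxx.
  rewrite eqSS => /and3P[sw xs rw]; exists x, w; split=> //.
    by rewrite mem_iota.
  by rewrite IHm sw.
Qed.

Lemma nwordsS m s :
  nwords m.+1 s = c s.+1 * nwords m 0 + (s.+1 < L) * nwords m s.+1.
Proof.
rewrite /nwords /= size_allpairs_dep /nletters iotaD map_cat sumn_cat add0n.
congr (_ + _).
  elim: {-2}(c s.+1) (leqnn (c s.+1)) => [|n IHn] nc //.
  rewrite -addn1 iotaD map_cat sumn_cat IHn ?(ltnW nc) //= addn0 add0n.
  by rewrite /step nc mulnDl mul1n.
by case: (s.+1 < L) => //=; rewrite /step ltnn mul1n addn0.
Qed.

Lemma nwords_sum m s : s < L ->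
  nwords m s = \sum_(1 <= j < (minn m (L - s)).+1) c (s + j) * nwords (m - j) 0
               + (m < L - s).
Proof.
elim: m s => [|m IHm] s sL.
  by rewrite min0n big_geq // subn_gt0 sL.
rewrite nwordsS (_ : L - s = (L - s.+1).+1); last by lia.
rewrite minnSS big_nat_recl // addn1 subn1 ltnS -addnA; congr (_ + _).
have [s1L|s1L] := ltnP s.+1 L; last first.
  by rewrite mul0n (_ : L - s.+1 = 0) ?minn0 ?big_geq //; lia.
rewrite mul1n IHm //; congr (_ + _).
by rewrite !big_nat; apply: eq_bigr => j _; rewrite addnS.
Qed.

Lemma nwords_plr m : nwords m 0 = plr L c m.+1.
Proof.
elim/ltn_ind: m => m IHm; rewrite nwords_sum // subn0 plrS.
congr (_ + _); rewrite !big_nat; apply: eq_bigr => j /andP[j0 jm].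
by rewrite IHm ?subSn //; lia.
Qed.

Notation value := (decomp_value L c).

Lemma value_cons x w : value (x :: w) = x * plr L c (size w).+1 + value w.
Proof.
rewrite /decomp_value /= big_nat_recl // subn0; congr (_ + _).
Qed.

(** After a digit [x < c s.+1] any word from state 0 may follow, and by induction
    these take the values [0, ..., nwords m 0 - 1]; since the weight of [x] is
    [G_(m+1) = nwords m 0], successive first digits give adjacent intervals. *)
Lemma value_words m s : s < L ->
  [seq value w | w <- words m s] = iota 0 (nwords m s).
Proof.
elim: m s => [|m IHm] s sL.
  by rewrite /nwords /= /decomp_value big_geq.
transitivity (flatten [seq iota (x * nwords m 0) (nwords m (step s x))
                      | x <- iota 0 (nletters s)]).
  rewrite map_flatten; congr flatten; rewrite -map_comp.
  apply/eq_in_map => x; rewrite mem_iota /= => xs.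
  rewrite -[x * _]addn0 iotaDl -IHm ?step_lt // -!map_comp.
  apply/eq_in_map => w; rewrite mem_words => /andP[/eqP sw _] /=.
  by rewrite value_cons sw nwords_plr.
rewrite nwordsS /nletters !iotaD map_cat flatten_cat !add0n; congr (_ ++ _).
  elim: {-2}(c s.+1) (leqnn (c s.+1)) => [|n IHn] nc //.
  rewrite -addn1 iotaD map_cat flatten_cat IHn ?(ltnW nc) // add0n.
  by rewrite /= cats0 /step nc mulnDl mul1n iotaD add0n.
by case: (s.+1 < L) => //=; rewrite /step ltnn cats0 mul1n.
Qed.

Lemma nth_words_value m s w : s < L -> w \in words m s ->
  value w < nwords m s /\ nth [::] (words m s) (value w) = w.
Proof.
move=> sL wm; have im : index w (words m s) < nwords m s by rewrite index_mem.
suff -> : value w = index w (words m s) by rewrite nth_index.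
rewrite -{1}(nth_index [::] wm) -(nth_map _ 0) // value_words //.
by rewrite nth_iota.
Qed.

Lemma value_nth_words m s N : s < L -> N < nwords m s ->
  value (nth [::] (words m s) N) = N.
Proof.
by move=> sL Nm; rewrite -(nth_map _ 0) // value_words // nth_iota.
Qed.

Lemma read_coefficients s k : s + k < L ->
  readable s [seq c i | i <- iota s.+1 k] /\
  state s [seq c i | i <- iota s.+1 k] = s + k.
Proof.
elim: k s => [|k IHk] s sk /=; first by rewrite addn0.
have [IH1 IH2] := IHk s.+1 ltac:(lia).
rewrite {1}/step ltnn IH1 /nletters (_ : s.+1 < L) ?addn1 ?ltnSn; last by lia.
by split=> //; rewrite /state /= {2}/step ltnn addnS -addSn -IH2.
Qed.

Lemma state_nseq0 l : state 0 (nseq l 0) = 0.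
Proof. by elim: l => //= l; rewrite /step c1_gt0. Qed.

Lemma readable_nseq0 l : readable 0 (nseq l 0).
Proof.
elim: l => //= l; rewrite /step c1_gt0 => ->.
by rewrite /nletters; lia.
Qed.

Lemma block_returns s x l : 1 <= s <= L -> x < c s ->
  let a := rcons [seq c i | i <- iota 1 s.-1] x ++ nseq l 0 in
  readable 0 a /\ state 0 a = 0.
Proof.
case: s => // s /= sL xs.
have [r1 r2] := @read_coefficients 0 s ltac:(lia).
rewrite readable_cat -cats1 readable_cat !state_cat r1 r2 /= add0n /step xs /nletters.
by rewrite readable_nseq0 // state_nseq0 // !andbT; split=> //; lia.
Qed.

Lemma legal_readable a : legal L c a -> readable 0 a /\ 0 < head 0 a.
Proof.
elim=> [n /andP[n0 nL] _|s x l sL xs h0 h0P|s x l b sL xs h0 h0P _ [IHb _]].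
- have [r1 r2] := @read_coefficients 0 n nL; split=> //.
  by case: n n0 {nL r1 r2}.
- have [r _] := block_returns l sL xs; split=> //.
  by move: h0P; rewrite /h0; case: [seq _ | _ <- _].
- rewrite catA readable_cat.
  have [-> ->] := block_returns l sL xs; split=> //.
  by move: h0P; rewrite /h0; case: [seq _ | _ <- _].
Qed.

(** Reading from state [s], either the coefficients [c] are followed to the end of
    the word, or a first smaller digit [x] closes the current block. *)
Lemma readable_parse s w : s < L -> readable s w ->
  (w = [seq c i | i <- iota s.+1 (size w)] /\ s + size w < L) \/
  exists k x v, [/\ s + k < L, x < c (s + k).+1, readable 0 v &
    w = rcons [seq c i | i <- iota s.+1 k] x ++ v].
Proof.
elim: w s => [|x w IHw] s sL /=; first by left; rewrite addn0.
move=> /andP[xs]; rewrite /step; case: ltnP => xc rw.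
  by right; exists 0, x, w; rewrite addn0.
have s1L : s.+1 < L by move: xs; rewrite /nletters; lia.
have {xs xc} -> : x = c s.+1 by move: xs; rewrite /nletters; lia.
have [[wE sw]|[k [y [v [kL yk rv ->]]]]] := IHw _ s1L rw.
  by left; rewrite addnS [in LHS]wE.
by right; exists k.+1, y, v; rewrite addnS.
Qed.

Lemma readable_legal a : readable 0 a -> 0 < head 0 a ->
  legal L c a.
Proof.
elim: {a}(size a) {-2}a (leqnn (size a)) => [|n IHn] a an ra ha.
  by case: a an ha {ra}.
have [[aE aL]|[k [x [v [kL xk rv a_eq]]]]] := readable_parse L_gt0 ra.
  rewrite aE; apply: legal_short => //; rewrite add0n in aL; rewrite aL andbT.
  by case: a ha {ra an aL aE}.
have hx : 0 < head 0 (rcons [seq c i | i <- iota 1 k] x).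
  by move: ha; rewrite a_eq; case: [seq _ | _ <- _].
have kL' : 1 <= k.+1 <= L by [].
have vn : size v <= n by move: an; rewrite a_eq size_cat size_rcons; lia.
rewrite a_eq.
have [l [b [vE [bE|[rb hb]]]]] : exists l b, v = nseq l 0 ++ b /\
    (b = [::] \/ readable 0 b /\ 0 < head 0 b).
  elim: v rv {a_eq vn} => [|[|y] v IHv] rv.
  - by exists 0, [::]; split=> //; left.
  - have [|l [b [-> bP]]] := IHv.
      by move: rv => /= /andP[_]; rewrite /step c1_gt0.
    by exists l.+1, b.
  - by exists 0, (y.+1 :: v); split=> //; right.
- by rewrite vE bE cats0; apply: (@legal_end L c k.+1).
- rewrite vE; apply: (@legal_cat L c k.+1) => //.
  by apply: IHn => //; move: vn; rewrite vE size_cat; lia.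
Qed.

Lemma plr_homo m n : m <= n -> plr L c m.+1 <= plr L c n.+1.
Proof.
move=> /subnK <-; elim: (n - m) => //= k IHk; apply: leq_trans IHk _.
by rewrite addSn -!nwords_plr // nwordsS; nia.
Qed.

Lemma word_head_gt0 m w : w \in words m.+1 0 ->
  (0 < head 0 w) = (plr L c m.+1 <= value w).
Proof.
rewrite mem_words => /andP[].
case: w => // x w /=; rewrite eqSS => /eqP sw; rewrite value_cons sw.
case: x => [|x] /andP[_ rw]; last by lia.
have wm : w \in words m 0 by rewrite mem_words sw eqxx; move: rw; rewrite /step c1_gt0.
have [vm _] := nth_words_value L_gt0 wm.
by rewrite add0n ltnn leqNgt -nwords_plr // vm.
Qed.

(** The word of rank [N] is a legal decomposition of [N].  Any other one is a
    word of some length [m + 1]; its value lies in [G_(m+1), G_(m+2)), which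
    forces [m = n], and a word of known length is determined by its value. *)
Lemma decomp_words n N :
  plr L c n.+1 <= N < plr L c n.+2 -> decomp L c N = nth [::] (words n.+1 0) N.
Proof.
move=> /andP[nN Nn].
have Nw : N < nwords n.+1 0 by rewrite nwords_plr.
set w := nth [::] (words n.+1 0) N.
have ww : w \in words n.+1 0 by rewrite mem_nth.
have vw : value w = N by rewrite value_nth_words.
have lw : legal L c w /\ value w = N.
  split=> //; apply: readable_legal => //; last first.
    by rewrite (word_head_gt0 ww) vw.
  by move: ww; rewrite mem_words => /andP[].
have := xgetPex [::] (ex_intro _ w lw :
  exists a, [set a | legal L c a /\ value a = N]%classic a).
rewrite -/(decomp L c N) => -[/legal_readable [rd hd] vd].
case sd: (size (decomp L c N)) => [|m]; first by case: (decomp L c N) sd hd.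
have dm : decomp L c N \in words m.+1 0 by rewrite mem_words sd eqxx.
have [vdm nd] := nth_words_value L_gt0 dm.
move: hd; rewrite (word_head_gt0 dm) vd => md.
suff nm : n = m by rewrite -nd vd /w nm.
rewrite vd nwords_plr // in vdm.
case: (ltngtP n m) => // /plr_homo.
  by rewrite leqNgt (leq_ltn_trans md Nn).
by rewrite leqNgt (leq_ltn_trans nN vdm).
Qed.

End Words.

(** * Counting words from different states *)

Lemma sum_words_cat (V : nmodType) a b s (F : seq nat -> V) :
  \sum_(w <- words (a + b) s) F w =
  \sum_(p <- words a s) \sum_(q <- words b (state s p)) F (p ++ q).
Proof.
elim: a s F => [|a IHa] s F; first by rewrite /= big_seq1.
rewrite /= !big_allpairs_dep; apply: eq_bigr => x _.
by rewrite IHa; apply: eq_bigr.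
Qed.

Lemma nwords_cat a b s :
  nwords (a + b) s = (\sum_(p <- words a s) nwords b (state s p))%N.
Proof.
rewrite /nwords -sum1_size (sum_words_cat _ _ _ (fun=> 1%N)).
by apply: eq_bigr => p _; rewrite sum1_size.
Qed.

Lemma state_words m s p : (s < L)%N -> p \in words m s -> (state s p < L)%N.
Proof. by rewrite mem_words => sL /andP[_ ?]; exact: state_lt. Qed.

(** Follow the coefficients up to state [L - 1], leave it by the digit 0, which is
    below [c L], and wait in state 0, where 0 is allowed because [c 1] is
    positive. *)
Lemma path_to_zero s : (s < L)%N -> exists2 p, p \in words L s & state s p = 0%N.
Proof.
move=> sL; have [//|r1 r2] := @read_coefficients s (L.-1 - s); first by lia.
exists ([seq c i | i <- iota s.+1 (L.-1 - s)] ++ nseq s.+1 0%N).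
  rewrite mem_words size_cat size_map size_iota size_nseq readable_cat r1 r2.
  rewrite subnKC /=; last by lia.
  rewrite /step /nletters prednK // cL_gt0 readable_nseq0 // addn_gt0 cL_gt0.
  by rewrite /= andbT; lia.
rewrite state_cat r2 subnKC /=; last by lia.
by rewrite /step prednK // cL_gt0; apply: state_nseq0.
Qed.

Lemma path_from_zero t : (t < L)%N -> exists2 p, p \in words L 0 & state 0 p = t.
Proof.
move=> tL; have [//|r1 r2] := @read_coefficients 0 t.
exists (nseq (L - t) 0%N ++ [seq c i | i <- iota 1 t]).
  rewrite mem_words size_cat size_map size_iota size_nseq readable_cat.
  by rewrite state_nseq0 // readable_nseq0 // r1 subnK ?eqxx // ltnW.
by rewrite state_cat state_nseq0.
Qed.

Lemma nwords_state a m s p : p \in words a s ->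
  (nwords m (state s p) <= nwords (a + m) s)%N.
Proof. by move=> pa; rewrite nwords_cat (big_rem p) //= leq_addr. Qed.

Lemma nwords_gt0 m s : (s < L)%N -> (0 < nwords m s)%N.
Proof.
elim: m s => [//|m IHm] s sL; rewrite nwordsS addn_gt0 !muln_gt0 IHm // andbT.
have [s1L|s1L] := ltnP s.+1 L; first by rewrite IHm // orbT.
by rewrite (_ : s.+1 = L) ?cL_gt0 //; apply/eqP; rewrite eqn_leq sL.
Qed.

(** States communicate in exactly [L] steps, so the numbers of words from two
    states differ by at most the bounded factor by which [L] more digits multiply
    the number of words. *)
Lemma nwords_comparable a : exists2 B, (0 < B)%N & forall m s t,
  (s < L)%N -> (t < L)%N -> (nwords (a + m) s <= B * nwords m t)%N.
Proof.
have growth b : exists B, forall m s, (s < L)%N ->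
    (nwords (m + b) s <= B * nwords m s)%N.
  exists (\sum_(t < L) nwords b t)%N => m s sL.
  rewrite nwords_cat -iter_addn_0 /nwords -count_predT -big_const_seq.
  rewrite !big_seq; apply: leq_sum => p ps.
  by rewrite (big_rem (Ordinal (state_words sL ps))) ?mem_index_enum //= leq_addr.
have [Ba Ba_le] := growth a; have [B B_le] := growth L.
exists (Ba * B * B).+1 => // m s t sL tL.
suff : (nwords (a + m) s <= Ba * B * B * nwords m t)%N.
  by move=> h; apply: leq_trans h _; rewrite leq_mul2r leqnSn orbT.
rewrite addnC; apply: leq_trans (Ba_le m s sL) _; rewrite -!mulnA leq_mul2l.
apply/orP; right; have [p pL p0] := path_from_zero sL.
have [q qL q0] := path_to_zero tL.
have := nwords_state m pL; rewrite p0 addnC => /leq_trans; apply.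
apply: leq_trans (B_le m 0%N L_gt0) _; rewrite leq_mul2l; apply/orP; right.
by have := nwords_state m qL; rewrite q0 addnC => /leq_trans; apply; exact: B_le.
Qed.

(** * Averages over words *)

Variable R : realType.

Definition sumw m s (F : seq nat -> R) := \sum_(w <- words m s) F w.
Definition avg m s (F : seq nat -> R) := sumw m s F / (nwords m s)%:R.

Lemma nwordsR_gt0 m s : (s < L)%N -> 0 < (nwords m s)%:R :> R.
Proof. by move=> sL; rewrite ltr0n nwords_gt0. Qed.

Lemma sumw_cat a b s F :
  sumw (a + b) s F =
  \sum_(p <- words a s) sumw b (state s p) (fun q => F (p ++ q)).
Proof. exact: sum_words_cat. Qed.

Lemma sumw_avg m s F : (s < L)%N -> sumw m s F = avg m s F * (nwords m s)%:R.
Proof. by move=> sL; rewrite divfK // gt_eqF // nwordsR_gt0. Qed.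

Lemma sumw_cst m s x : sumw m s (fun=> x) = x * (nwords m s)%:R.
Proof. by rewrite /sumw big_const_seq count_predT iter_addr addr0 mulr_natr. Qed.

Lemma le_sumw m s F G : (forall w, w \in words m s -> F w <= G w) ->
  sumw m s F <= sumw m s G.
Proof. by move=> FG; rewrite /sumw !big_seq; apply: ler_sum. Qed.

Lemma le_avg m s F G : (s < L)%N -> (forall w, w \in words m s -> F w <= G w) ->
  avg m s F <= avg m s G.
Proof.
by move=> sL FG; rewrite ler_pM2r ?invr_gt0 ?nwordsR_gt0 //; apply: le_sumw.
Qed.

Lemma avg_cst m s x : (s < L)%N -> avg m s (fun=> x) = x.
Proof. by move=> sL; rewrite /avg sumw_cst mulfK // gt_eqF // nwordsR_gt0. Qed.

Lemma avgD m s F G : avg m s (fun w => F w + G w) = avg m s F + avg m s G.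
Proof. by rewrite /avg /sumw big_split /= mulrDl. Qed.

Lemma avgZ m s x F : avg m s (fun w => x * F w) = x * avg m s F.
Proof. by rewrite /avg /sumw -mulr_sumr mulrA. Qed.

Lemma avgB m s F G : avg m s (fun w => F w - G w) = avg m s F - avg m s G.
Proof. by rewrite /avg /sumw sumrB mulrBl. Qed.

Lemma ler_norm_avg m s F : `|avg m s F| <= avg m s (fun w => `|F w|).
Proof.
rewrite normrM [`|_^-1|]ger0_norm ?invr_ge0 //; apply: ler_wpM2r => //.
exact: ler_norm_sum.
Qed.

Lemma nwordsR_cat a b s :
  (nwords (a + b) s)%:R = \sum_(p <- words a s) (nwords b (state s p))%:R :> R.
Proof. by rewrite nwords_cat natr_sum. Qed.

Lemma avg_close m s F x e : (s < L)%N ->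
  (forall w, w \in words m s -> `|F w - x| <= e) -> `|avg m s F - x| <= e.
Proof.
move=> sL Fx; rewrite -{1}(avg_cst m x sL) -avgB.
apply: le_trans (ler_norm_avg _ _ _) _; rewrite -[leRHS](avg_cst m _ sL).
exact: le_avg.
Qed.

(** * Concentration of quasi-additive statistics *)

Section Concentration.

Variables (S : seq nat -> R) (C : R).
Hypothesis S_cat : forall p q, `|S (p ++ q) - S p - S q| <= C.
Hypothesis S_letter : forall x, `|S [:: x]| <= C.

Let C_ge0 : 0 <= C. Proof. exact: le_trans (S_letter 0%N). Qed.

Lemma quasi_additive_linear w : `|S w| <= C + 2 * C * (size w)%:R.
Proof.
elim: w => [|x w IHw].
  have := S_cat [::] [::]; rewrite /= => h; rewrite mulr0 addr0.
  by move: h; rewrite -normrN; congr (`|_| <= _); ring.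
have := S_cat [:: x] w; have := S_letter x; move: IHw.
rewrite /= -[(size w).+1]addn1 natrD !ler_norml; set t := 2 * C * (size w)%:R.
have -> : 2 * C * ((size w)%:R + 1) = t + 2 * C by rewrite /t; ring.
by lra.
Qed.

Let size_words m s w : w \in words m s -> size w = m.
Proof. by rewrite mem_words => /andP[/eqP]. Qed.

(** A Doeblin argument.  Among the words of length [L + l] from any state, a
    proportion at least [1 / B] is in state 0 after [L] digits.  If the means over
    length [l] fill an interval of length [K], then those over length [L + l] lie
    in one of length [(1 - 1 / B) * K + 2 * E], where [E] bounds the effect of the
    first [L] digits; [K = 2 * E * B] is the fixed point. *)
Lemma avg_spread : exists2 K, 0 <= K & forall m, exists a, forall s, (s < L)%N ->
  a <= avg m s S <= a + K.
Proof.
have [B B_gt0 B_le] := nwords_comparable L.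
pose E := 2 * C + 2 * C * L%:R.
have E_ge0 : 0 <= E by rewrite addr_ge0 ?mulr_ge0.
have B_ge1 : 1 <= B%:R :> R by rewrite ler1n.
pose K := 2 * E * B%:R.
have K_ge : 2 * E <= K by rewrite /K ler_peMr // mulr_ge0.
exists K => [|m]; first by rewrite (le_trans _ K_ge) // mulr_ge0.
rewrite (divn_eq m L); move: (m %/ L)%N (ltn_pmod m L_gt0) => q.
move: (m %% L)%N => r rL; elim: q => [|q [a aP]].
  exists (- E) => s sL; rewrite mul0n add0n.
  have : `|avg r s S - 0| <= E.
    apply: (avg_close sL) => w /size_words sw; rewrite subr0.
    apply: le_trans (quasi_additive_linear w) _; rewrite sw /E lerD //.
      by rewrite ler_peMl // ler1n.
    by apply: ler_wpM2l; rewrite ?mulr_ge0 // ler_nat ltnW.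
  by rewrite subr0 ler_norml; lra.
rewrite mulSn -addnA; move: (q * L + r)%N aP => l aP {q r rL m}.
pose v0 := avg l 0 S; have /andP[av0 v0a] := aP 0%N L_gt0.
exists (a - E + (v0 - a) / B%:R) => s sL.
have [p pL p0] := path_to_zero sL.
have hs : 0 < (nwords (L + l) s)%:R :> R by apply: nwordsR_gt0.
have h0 : (nwords (L + l) s)%:R / B%:R <= (nwords l 0)%:R :> R.
  by rewrite ler_pdivrMr ?ltr0n // -natrM ler_nat mulnC; apply: B_le.
(* the first [L] digits [p'] affect the mean over their continuations by at
   most [E] *)
have part p' : p' \in words L s ->
    `|sumw l (state s p') (fun q => S (p' ++ q))
      - avg l (state s p') S * (nwords l (state s p'))%:R|
    <= E * (nwords l (state s p'))%:R.
  set t := state s p' => p'L; have tL : (t < L)%N := state_words sL p'L.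
  rewrite sumw_avg // -mulrBl normrM [`|_%:R|]ger0_norm // ler_wpM2r //.
  rewrite -avgB -[X in `|X|]subr0; apply: (avg_close tL) => w _.
  have := S_cat p' w; have := quasi_additive_linear p'; rewrite (size_words p'L) subr0 /E.
  by rewrite !ler_norml; lra.
rewrite /avg ler_pdivlMr // ler_pdivrMr // sumw_cat.
(* the word [p] is set apart: its continuations have the mean [v0] of state 0 *)
have up : \sum_(p' <- words L s) sumw l (state s p') (fun q => S (p' ++ q))
    <= (a + K + E) * (nwords (L + l) s)%:R - (a + K - v0) * (nwords l 0)%:R.
  rewrite nwordsR_cat mulr_sumr !(big_rem p pL) /= addrAC lerD //.
    have := part p pL; rewrite p0 -/v0 /= ler_norml; lra.
  rewrite !big_seq; apply: ler_sum => p' /mem_rem p'L.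
  have tL := state_words sL p'L.
  have /andP[_ h] := aP _ tL; have := part p' p'L; rewrite /= ler_norml.
  have : avg l (state s p') S * (nwords l (state s p'))%:R
    <= (a + K) * (nwords l (state s p'))%:R by apply: ler_wpM2r.
  lra.
have lo : (a - E) * (nwords (L + l) s)%:R + (v0 - a) * (nwords l 0)%:R
    <= \sum_(p' <- words L s) sumw l (state s p') (fun q => S (p' ++ q)).
  rewrite nwordsR_cat mulr_sumr !(big_rem p pL) /= addrAC lerD //.
    have := part p pL; rewrite p0 -/v0 /= ler_norml; lra.
  rewrite !big_seq; apply: ler_sum => p' /mem_rem p'L.
  have tL := state_words sL p'L.
  have /andP[h _] := aP _ tL; have := part p' p'L; rewrite /= ler_norml.
  have : a * (nwords l (state s p'))%:R
    <= avg l (state s p') S * (nwords l (state s p'))%:R by apply: ler_wpM2r.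
  lra.
apply/andP; split.
  apply: le_trans lo; rewrite mulrDl lerD2l -mulrA [_^-1 * _]mulrC.
  by rewrite ler_wpM2l // subr_ge0.
apply: le_trans up _.
have : (a + K - v0) * ((nwords (L + l) s)%:R / B%:R) <=
       (a + K - v0) * (nwords l 0)%:R by rewrite ler_wpM2l // subr_ge0.
set h := (nwords (L + l) s)%:R in hs *; set y := _ * (nwords l 0)%:R => hy.
have -> : (a - E + (v0 - a) / B%:R + K) * h =
   (a + K + E) * h - (a + K - v0) * (h / B%:R).
  by rewrite /K; field; rewrite gt_eqF ?ltr0n.
by rewrite lerD2l lerN2.
Qed.

Lemma sumw_sqr m s (F : seq nat -> R) y : (s < L)%N ->
  sumw m s (fun w => (F w - y) ^+ 2) =
  sumw m s (fun w => (F w - avg m s F) ^+ 2) +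
  (avg m s F - y) ^+ 2 * (nwords m s)%:R.
Proof.
move=> sL; set M := avg m s F.
have expand z : sumw m s (fun w => (F w - z) ^+ 2) =
    sumw m s (fun w => F w ^+ 2) - 2 * z * sumw m s F + z ^+ 2 * (nwords m s)%:R.
  rewrite -sumw_cst /sumw mulr_sumr -sumrB -big_split /=.
  by apply: eq_bigr => w _; ring.
by rewrite !expand (sumw_avg m F sL) -/M; ring.
Qed.

(** The total variance is the mean of the variances given the first digit plus
    the variance of the means given the first digit.  These means differ by a
    bounded amount, by [avg_spread].  The prefix [p] is there for the induction:
    since [S] is only quasi-additive, the statistic of what remains after a first
    digit [x] is not [S] up to a constant, but [S] of the word with [x] moved to
    the prefix. *)
Lemma variance_linear : exists2 K, 0 <= K & forall m s p, (s < L)%N ->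
  sumw m s (fun w => (S (p ++ w) - avg m s (fun w => S (p ++ w))) ^+ 2)
  <= K * m%:R * (nwords m s)%:R.
Proof.
have [K K_ge0 spread] := avg_spread.
exists ((K + 6 * C) ^+ 2) => [|m]; first exact: sqr_ge0.
elim: m => [|m IHm] s p sL.
  rewrite mulr0 mul0r /sumw /= big_seq1 /avg /sumw /= big_seq1 divr1 subrr.
  by rewrite expr0n.
have [a aP] := spread m.
pose mean p' := avg m (state s p') (fun w => S ((p ++ p') ++ w)).
have mean_close p' : p' \in words 1 s -> 
    a - 3 * C <= mean p' - S p <= a + K + 3 * C.
  move=> p'1; have tL := state_words sL p'1.
  have /andP[a1 a2] := aP _ tL.
  suff : `|mean p' - avg m (state s p') S - S p| <= 3 * C.
    by rewrite ler_norml; lra.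
  rewrite -avgB; apply: (avg_close tL) => w _.
  have [x ->] : exists x, p' = [:: x].
    by move: (size_words p'1); case: (p') => [|x []] // _; exists x.
  have := S_cat p ([:: x] ++ w); have := S_cat [:: x] w; have := S_letter x.
  by rewrite catA !ler_norml; lra.
rewrite -add1n; set M := avg _ _ _.
have M_close : a - 3 * C <= M - S p <= a + K + 3 * C.
  suff : `|M - (S p + a + K / 2)| <= 3 * C + K / 2.
    by rewrite ler_norml; lra.
  have hs : 0 < (nwords (1 + m) s)%:R :> R by apply: nwordsR_gt0.
  rewrite -(ler_pM2r hs) -[X in _ * X <= _]gtr0_norm // -normrM mulrBl.
  rewrite -(sumw_avg _ _ sL) sumw_cat nwordsR_cat !mulr_sumr -sumrB.
  apply: le_trans (ler_norm_sum _ _ _) _; rewrite !big_seq.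
  apply: ler_sum => p' p'1; have tL := state_words sL p'1.
  under eq_fun do rewrite catA.
  rewrite sumw_avg // -/(mean p') -mulrBl normrM [`|_%:R|]ger0_norm //.
  rewrite ler_wpM2r //; have := mean_close p' p'1; rewrite ler_norml; lra.
rewrite sumw_cat nwordsR_cat mulr_sumr !big_seq; apply: ler_sum => p' p'1.
have tL := state_words sL p'1.
under eq_fun do rewrite catA.
rewrite sumw_sqr // -/(mean p') natrD mulrDr mulr1 addrC mulrDl.
apply: lerD; last exact: IHm.
apply: ler_wpM2r => //; rewrite -ler_sqrt ?sqr_ge0 // !sqrtr_sqr.
rewrite [leRHS]ger0_norm ?addr_ge0 ?mulr_ge0 //.
by have := mean_close p' p'1; move: M_close; rewrite ler_norml; lra.
Qed.

(** [|x| <= d * x^2 + 1/d] turns the variance bound into one for the absolute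
    deviation, without square roots. *)
Lemma deviation eta : 0 < eta -> exists2 K, 0 <= K & forall m,
  sumw m 0 (fun w => `|S w - avg m 0 S|) <= (eta * m%:R + K) * (nwords m 0)%:R.
Proof.
move=> eta0; have [K K_ge0 varK] := variance_linear.
pose d := eta / (K + 1).
have K1 : 0 < K + 1 by rewrite ltr_wpDl.
have d0 : 0 < d by rewrite divr_gt0.
exists d^-1 => [|m]; first by rewrite invr_ge0 ltW.
have pointwise (x : R) : `|x| <= d * x ^+ 2 + d^-1.
  rewrite -(ler_pM2l d0) mulrDr mulfV ?gt_eqF // -real_normK ?num_real //.
  have := sqr_ge0 (d * `|x| - 1 / 2); nra.
apply: le_trans (le_sumw (fun w _ => pointwise (S w - avg m 0 S))) _.
rewrite {1}/sumw big_split /= -mulr_sumr mulrDl lerD //; last first.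
  by rewrite -sumw_cst.
apply: le_trans (ler_wpM2l (ltW d0) (varK m 0%N [::] L_gt0)) _.
rewrite !mulrA ler_wpM2r // ler_wpM2r // /d mulrAC ler_pdivrMr //.
by rewrite ler_wpM2l ?ltW // ltrDl.
Qed.

(** Cut a word of length [m + l] after [m] digits.  The prefix [p] occurs with
    weight [nwords l (state 0 p)] instead of uniformly; these weights are
    comparable, so the deviation of [S p] from its uniform mean is still small on
    average. *)
Lemma near_additive eta : 0 < eta -> exists2 K, 0 <= K & forall m l,
  `|avg (m + l) 0 S - avg m 0 S - avg l 0 S| <= eta * m%:R + K.
Proof.
move=> eta0; have [K K_ge0 spread] := avg_spread.
have [B B_gt0 B_le] := nwords_comparable 0.
have BR : 0 < B%:R :> R by rewrite ltr0n.
have [D D_ge0 devD] := deviation (divr_gt0 eta0 (exprn_gt0 2 BR)).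
(* one factor [B] bounds the weight [nwords l (state 0 p)] by [nwords l 0], the
   other compares [nwords m 0 * nwords l 0] with [nwords (m + l) 0] *)
exists (B%:R ^+ 2 * D + (C + K)) => [|m l].
  by rewrite !addr_ge0 ?mulr_ge0 ?exprn_ge0 // ltW.
have hs : 0 < (nwords (m + l) 0)%:R :> R by apply: nwordsR_gt0.
rewrite -(ler_pM2r hs) -[X in _ * X <= _]gtr0_norm // -normrM !mulrBl.
rewrite -sumw_avg // sumw_cat -addrA -opprD -mulrDl nwordsR_cat mulr_sumr -sumrB.
apply: le_trans (ler_norm_sum _ _ _) _; rewrite -nwordsR_cat.
have term p : p \in words m 0 ->
   `|sumw l (state 0 p) (fun q => S (p ++ q)) -
      (avg m 0 S + avg l 0 S) * (nwords l (state 0 p))%:R|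
   <= (C + K) * (nwords l (state 0 p))%:R +
      B%:R * (nwords l 0)%:R * `|S p - avg m 0 S|.
  move=> pm; have tL := state_words L_gt0 pm.
  set t := state 0 p in tL *.
  have hB : (nwords l t)%:R <= B%:R * (nwords l 0)%:R :> R.
    by rewrite -natrM ler_nat; apply: B_le.
  have : `|avg l t (fun q => S (p ++ q)) - (S p + avg l t S)| <= C.
    rewrite opprD addrA addrAC.
    rewrite -avgB; apply: (avg_close tL) => w _.
    by have := S_cat p w; congr (`|_| <= _); ring.
  have : `|avg l t S - avg l 0 S| <= K.
    have [a aP] := spread l; have := aP _ tL; have := aP _ L_gt0.
    by rewrite ler_norml; lra.
  move=> h1 h2; rewrite sumw_avg // -mulrBl normrM [`|_%:R|]ger0_norm //.
  set h := (nwords l t)%:R in hB *.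
  have h_ge0 : 0 <= h by [].
  apply: (@le_trans _ _ ((C + K + `|S p - avg m 0 S|) * h)).
    apply: ler_wpM2r => //.
    set x := S p - _; set y := avg l t _ - _ in h2; set z := _ - avg l 0 S in h1.
    rewrite (_ : _ - _ = y + z + x); last by rewrite /x /y /z; ring.
    by apply: le_trans (ler_normD _ _) _; rewrite lerD2r;
      apply: le_trans (ler_normD _ _) _; apply: lerD.
  by rewrite mulrDl lerD2l mulrC ler_wpM2r.
apply: (@le_trans _ _ (\sum_(p <- words m 0)
    ((C + K) * (nwords l (state 0 p))%:R +
      B%:R * (nwords l 0)%:R * `|S p - avg m 0 S|))).
  by rewrite !big_seq; apply: ler_sum.
rewrite big_split /= -!mulr_sumr -nwordsR_cat.
set h := (nwords (m + l) 0)%:R.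
have prod_le : (nwords l 0)%:R * (nwords m 0)%:R <= B%:R * h.
  rewrite /h nwordsR_cat mulr_sumr -sumw_cst /sumw !big_seq; apply: ler_sum => p pm.
  rewrite -natrM ler_nat; apply: (B_le l 0%N) => //.
  exact: state_words pm.
have := ler_wpM2l (mulr_ge0 (ltW BR) (ler0n _ (nwords l 0))) (devD m).
rewrite -/(sumw m 0 _) => dev.
have : B%:R * (nwords l 0)%:R * ((eta / B%:R ^+ 2 * m%:R + D) * (nwords m 0)%:R)
   <= (eta * m%:R + B%:R ^+ 2 * D) * h.
  rewrite (_ : _ * _ = (eta / B%:R ^+ 2 * m%:R + D) * B%:R *
     ((nwords l 0)%:R * (nwords m 0)%:R)); last by ring.
  apply: le_trans (ler_wpM2l _ prod_le) _.
    apply: mulr_ge0; last exact: ltW.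
    by apply: addr_ge0 => //; apply: mulr_ge0 => //; rewrite divr_ge0 // ltW.
  rewrite le_eqVlt; apply/orP; left; apply/eqP; field.
  by rewrite gt_eqF.
rewrite /sumw in dev *.
lra.
Qed.

End Concentration.

(** * The law of large numbers under the uniform law on integers *)

Hypothesis Lc_neq : (L, c 1%N) <> (1%N, 1%N).

Notation EQ := (EQ (R := R) L c).

(** For [L = 1] the only digits are [0, ..., c 1 - 1]: excluding
    [(L, c 1) = (1, 1)] is what leaves room for a nonzero digit. *)
Lemma letter1_allowed : (1 < nletters 0)%N.
Proof.
rewrite /nletters; case: (ltngtP L 1) => [|L1|L1]; [by lia| by lia|].
have : c 1 <> 1%N by move=> c1; apply: Lc_neq; rewrite L1 c1.
by lia.
Qed.

Definition Qcard n := (plr L c n.+2 - plr L c n.+1)%N.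

(** The words of length [n + 1] that start with the digit 1 are already a positive
    proportion of all. *)
Lemma nwords_le_Qcard : exists2 B, (0 < B)%N & forall n,
  (nwords n.+1 0 <= B * Qcard n)%N.
Proof.
have [B B_gt0 B_le] := nwords_comparable 1.
exists B => // n; rewrite /Qcard -!nwords_plr //.
have tL : (step 0 1 < L)%N by apply: step_lt => //; exact: letter1_allowed.
have := B_le n 0%N _ L_gt0 tL; rewrite add1n => /leq_trans; apply.
rewrite leq_mul2l; apply/orP; right; rewrite nwordsS /step.
have := letter1_allowed; rewrite /nletters; case: (ltnP 1 (c 1%N)) => c1 l1.
  have : (2 * nwords n 0 <= c 1 * nwords n 0)%N by rewrite leq_mul2r c1 orbT.
  by lia.
have -> : c 1 = 1%N by lia.
have -> : (1 < L)%N by lia.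
by rewrite !mul1n; lia.
Qed.

Lemma Qcard_gt0 n : (0 < Qcard n)%N.
Proof.
have [B _ /(_ n)] := nwords_le_Qcard; have := nwords_gt0 n.+1 L_gt0.
by case: (Qcard n); rewrite ?muln0 => // h1 /(leq_trans h1).
Qed.

Let Qcard_neq0 n : (Qcard n)%:R != 0 :> R.
Proof. by rewrite pnatr_eq0 -lt0n Qcard_gt0. Qed.

Definition Qrange n N := (plr L c n.+1 <= N < plr L c n.+2)%N.

Lemma Qrange_words n N : Qrange n N -> decomp L c N \in words n.+1 0.
Proof.
move=> nN; rewrite (@decomp_words n N) // mem_nth //.
by move: nN => /andP[_]; rewrite -nwords_plr.
Qed.

Lemma le_EQ n f g : (forall N, Qrange n N -> f N <= g N) -> EQ n f <= EQ n g.
Proof.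
move=> fg; rewrite /Defs.EQ ler_wpM2r // !big_nat ler_sum // => N /fg //.
Qed.

Lemma EQ_cst n x : EQ n (fun=> x) = x.
Proof.
rewrite /Defs.EQ big_const_nat iter_addr addr0 -/(Qcard n) -[x *+ _]mulr_natr.
by rewrite mulfK.
Qed.

Lemma EQD n f g : EQ n (fun N => f N + g N) = EQ n f + EQ n g.
Proof. by rewrite /Defs.EQ big_split /= mulrDl. Qed.

Lemma EQZ n x f : EQ n (fun N => x * f N) = x * EQ n f.
Proof. by rewrite /Defs.EQ -mulr_sumr mulrA. Qed.

Lemma ler_norm_EQ n f : `|EQ n f| <= EQ n (fun N => `|f N|).
Proof.
rewrite /Defs.EQ normrM [`|_^-1|]ger0_norm ?invr_ge0 // ler_wpM2r //.
exact: ler_norm_sum.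
Qed.

Lemma EQ_le_avg : exists2 B : R, 0 < B & forall n F, (forall w, 0 <= F w) ->
  EQ n (fun N => F (decomp L c N)) <= B * avg n.+1 0 F.
Proof.
have [B B_gt0 B_le] := nwords_le_Qcard.
exists B%:R => [|n F F_ge0]; first by rewrite ltr0n.
have Q0 : 0 < (Qcard n)%:R :> R by rewrite ltr0n Qcard_gt0.
have W0 : 0 < (nwords n.+1 0)%:R :> R by rewrite ltr0n nwords_gt0.
have le_sum : \sum_(plr L c n.+1 <= N < plr L c n.+2) F (decomp L c N)
    <= sumw n.+1 0 F.
  rewrite /sumw (big_nth [::]) -/(nwords n.+1 0) nwords_plr //.
  rewrite [leRHS](big_cat_nat (n := plr L c n.+1)) //=; last exact: plr_homo.
  rewrite ler_wpDl ?sumr_ge0 // !big_nat; apply: ler_sum => N nN.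
  by rewrite (@decomp_words n N).
rewrite /Defs.EQ -/(Qcard n) ler_pdivrMr // /avg.
rewrite (_ : B%:R * _ * _ = sumw n.+1 0 F * (B%:R * (Qcard n)%:R)
                      / (nwords n.+1 0)%:R); last by ring.
rewrite ler_pdivlMr //.
apply: le_trans (_ : sumw n.+1 0 F * (nwords n.+1 0)%:R <= _).
  by rewrite ler_wpM2r.
by rewrite ler_wpM2l ?sumr_ge0 // -natrM ler_nat.
Qed.

(** Convergence in mean under [Q_n]: it passes to expectations, to finite sums and
    to uniform approximations, and it implies convergence in probability. *)
Definition EQ_cvg (X : nat -> nat -> R) x :=
  EQ n (fun N => `|X n N - x|) @[n --> \oo] --> (0 : R).

Lemma EQ_cvg_mean X x : EQ_cvg X x -> EQ n (X n) @[n --> \oo] --> x.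
Proof.
move=> Xx; apply/cvgrPdist_le => e e0.
have Xe := (cvgr0Pnorm_le _).1 Xx _ e0; near=> n.
apply: (@le_trans _ _ (EQ n (fun N => `|X n N - x|))).
  have -> : x - EQ n (X n) = - EQ n (fun N => X n N - x).
    by rewrite EQD EQ_cst opprB.
  rewrite normrN; exact: ler_norm_EQ.
by apply: le_trans (ler_norm _) _; near: n; exact: Xe.
Unshelve. all: by end_near. Qed.

Lemma EQ_cvg_approx X x :
  (forall e, 0 < e -> exists Y y, [/\ EQ_cvg Y y, `|x - y| <= e &
     \forall n \near \oo, forall N, Qrange n N -> `|X n N - Y n N| <= e]) ->
  EQ_cvg X x.
Proof.
move=> approx; apply/cvgr0Pnorm_le => e e0.
have [Y [y [Yy xy XY]]] := approx (e / 3) ltac:(by rewrite divr_gt0).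
have e3 : 0 < e / 3 by rewrite divr_gt0.
have Ye := (cvgr0Pnorm_le _).1 Yy _ e3.
near=> n; rewrite ger0_norm; last first.
  by rewrite -(EQ_cst n 0); apply: le_EQ.
apply: (@le_trans _ _ (EQ n (fun N => e / 3 + e / 3 + `|Y n N - y|))).
  have XYn : forall N, Qrange n N -> `|X n N - Y n N| <= e / 3 by near: n.
  apply: le_EQ => N nN; have := XYn N nN.
  rewrite (_ : X n N - x = X n N - Y n N + (Y n N - y) + (y - x)); last by ring.
  have := ler_normD (X n N - Y n N + (Y n N - y)) (y - x).
  have := ler_normD (X n N - Y n N) (Y n N - y).
  by rewrite [`|y - x|]distrC; lra.
rewrite EQD EQ_cst.
have : EQ n (fun N => `|Y n N - y|) <= e / 3.
  by apply: le_trans (ler_norm _) _; near: n; exact: Ye.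
lra.
Unshelve. all: by end_near. Qed.

Lemma EQ_cvg_sum (I : Type) (r : seq I) (P : pred I) (X : I -> nat -> nat -> R) x :
  (forall i, P i -> EQ_cvg (X i) (x i)) ->
  EQ_cvg (fun n N => \sum_(i <- r | P i) X i n N) (\sum_(i <- r | P i) x i).
Proof.
move=> Xx; apply: (@squeeze_cvgr _ _ _ _ (fun=> 0) (fun n =>
    \sum_(i <- r | P i) EQ n (fun N => `|X i n N - x i|))).
- near=> n; apply/andP; split; first by rewrite -(EQ_cst n 0); apply: le_EQ.
  elim: r => [|i r IHr].
    rewrite [leRHS]big_nil -[leRHS](EQ_cst n 0); apply: le_EQ => N _.
    by rewrite !big_nil subrr normr0.
  rewrite [leRHS]big_cons; case: ifP => Pi; last first.
    apply: le_trans IHr; apply: le_EQ => N _.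
    by rewrite !big_cons Pi.
  apply: le_trans (lerD (lexx _) IHr); rewrite -EQD; apply: le_EQ => N _.
  by rewrite !big_cons Pi opprD addrACA ler_normD.
- exact: cvg_cst.
- rewrite [X in _ --> X](_ : 0 = \sum_(i <- r | P i) (0 : R)); last by rewrite big1.
  by apply: cvg_big => [|i /Xx //]; exact: add_continuous.
Unshelve. all: by end_near. Qed.

Lemma EQ_cvg_prob X x (eps : R) : 0 < eps -> EQ_cvg X x ->
  EQ n (fun N => (`|X n N - x| > eps)%R%:R) @[n --> \oo] --> (0 : R).
Proof.
move=> eps0 Xx; apply: (@squeeze_cvgr _ _ _ _ (fun=> 0) (fun n =>
    eps^-1 * EQ n (fun N => `|X n N - x|))).
- near=> n; apply/andP; split; first by rewrite -(EQ_cst n 0); apply: le_EQ.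
  rewrite -EQZ; apply: le_EQ => N _; case: ltP => h /=; last first.
    by rewrite mulr_ge0 // invr_ge0 ltW.
  by rewrite mulrC ler_pdivlMr // mul1r ltW.
- exact: cvg_cst.
- by rewrite -(mulr0 eps^-1); apply: cvgM => //; exact: cvg_cst.
Unshelve. all: by end_near. Qed.

(** For the words of length [m] both the deviation from the mean and the distance
    of the mean to its limit are [o(m)]; the bounded density of [Q_n] transfers
    this. *)
Lemma law_of_large_numbers (S : seq nat -> R) C :
  (forall p q, `|S (p ++ q) - S p - S q| <= C) ->
  (forall x, `|S [:: x]| <= C) ->
  exists2 a, avg m 0 S / m%:R @[m --> \oo] --> a &
    EQ_cvg (fun n N => S (decomp L c N) / n.+1%:R) a.
Proof.
move=> S_cat S_letter.
have v_add := near_additive S_cat S_letter.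
have v_cvg := near_additive_cvg v_add.
pose v m := avg m 0 S; pose a := lim ((v m / m%:R) @[m --> \oo]).
exists a; first exact: v_cvg.
have [B B0 EQB] := EQ_le_avg; apply/cvgr0Pnorm_le => e e0.
have eB : 0 < e / (3 * B) by rewrite divr_gt0 // mulr_gt0.
have [K K_ge0 dev] := deviation S_cat S_letter eB.
have vS : v n.+1 / n.+1%:R @[n --> \oo] --> a.
  by rewrite (cvg_shiftS (fun m => v m / m%:R)).
have /cvgrPdist_le/(_ _ eB) va := vS.
near=> n; rewrite ger0_norm; last by rewrite -(EQ_cst n 0); apply: le_EQ.
have n0 : 0 < n.+1%:R :> R by rewrite ltr0n.
apply: le_trans (EQB n (fun w => `|S w / n.+1%:R - a|) _) _ => //.
have h : avg n.+1 0 (fun w => `|S w / n.+1%:R - a|) <=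
    avg n.+1 0 (fun w => n.+1%:R^-1 * `|S w - v n.+1| + `|a - v n.+1 / n.+1%:R|).
  apply: (le_avg L_gt0) => w _.
  rewrite (_ : _ - a = n.+1%:R^-1 * (S w - v n.+1) - (a - v n.+1 / n.+1%:R)).
    apply: le_trans (ler_normB _ _) _.
    by rewrite normrM [`|_^-1|]gtr0_norm // invr_gt0.
  by ring.
apply: le_trans (ler_wpM2l (ltW B0) h) _; rewrite avgD avgZ avg_cst //.
have h1 : `|a - v n.+1 / n.+1%:R| <= e / (3 * B) by near: n.
have h2 : K / n.+1%:R <= e / (3 * B).
  rewrite ler_pdivrMr // mulrC -ler_pdivrMr //.
  apply: (@le_trans _ _ n%:R); last by rewrite ler_nat.
  by rewrite ltW //; near: n; exact: nbhs_infty_gtr.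
have h3 : n.+1%:R^-1 * avg n.+1 0 (fun w => `|S w - v n.+1|) <=
   e / (3 * B) + K / n.+1%:R.
  rewrite mulrC ler_pdivrMr // mulrDl divfK ?gt_eqF // ler_pdivrMr.
    exact: dev.
  exact: nwordsR_gt0.
have -> : e = B * (e / (3 * B) + e / (3 * B) + e / (3 * B)).
  by field; rewrite gt_eqF.
apply: ler_wpM2l; first exact: ltW.
by apply: lerD h1; apply: le_trans h3 _; rewrite lerD2l.
Unshelve. all: by end_near. Qed.

(** * Densities of the gap lengths *)

Definition max_letter := (\sum_(s < L) nletters s)%N.
Notation gaps := (gaps max_letter).

Lemma words_max_letter m s w : (s < L)%N -> w \in words m s ->
  all (fun x => (x <= max_letter)%N) w.
Proof.
move=> sL; rewrite mem_words => /andP[_]; elim: w s sL => //= x w IHw s sL /andP[xs rw].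
apply/andP; split; last by apply: IHw rw; exact: step_lt.
apply: leq_trans (ltnW xs) _.
by rewrite /max_letter (big_rem (Ordinal sL)) ?mem_index_enum //= leq_addr.
Qed.

Lemma gap_count_decomp n k N : Qrange n N ->
  gap_count n k (digit L c N) = gaps k (decomp L c N).
Proof.
move=> nN; have dw := Qrange_words nN.
apply: gap_count_gaps; last exact: words_max_letter dw.
by move: dw; rewrite mem_words => /andP[/eqP].
Qed.

Lemma gap_law k : exists a,
  avg m 0 (fun w => (gaps k w)%:R) / m%:R @[m --> \oo] --> a /\
  EQ_cvg (fun n N => (gaps k (decomp L c N))%:R / n.+1%:R) a.
Proof.
have [||a a1 a2] := @law_of_large_numbers
  (fun w => (gaps k w)%:R) (max_letter.+1 * k.+1)%:R; last by exists a.
- move=> p q; have /andP[h1 h2] := gaps_cat max_letter k p q.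
  have h3 : (gaps k (p ++ q) <= gaps k p + gaps k q + max_letter.+1 * k.+1)%N.
    by apply: leq_trans h2 _; rewrite leq_add2l leq_mul2l geq_minr orbT.
  move: h1 h3; rewrite -!(ler_nat R) !natrD ler_norml => h1 h3.
  by have := ler0n R (max_letter.+1 * k.+1); lra.
- by move=> x; rewrite /= /head_gaps /= andbF; case: ifP; rewrite normr0.
Qed.

Section Densities.

Variable a : nat -> R.
Hypothesis a_avg : forall k : nat,
  avg m 0 (fun w => (gaps k w)%:R) / m%:R @[m --> \oo] --> a k.
Hypothesis a_EQ : forall k : nat,
  EQ_cvg (fun n N => (gaps k (decomp L c N))%:R / n.+1%:R) (a k).

Lemma density_ge0 k : 0 <= a k.
Proof.
apply: (cvgr_to_ge (@a_avg k)); apply: nearW => m.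
by rewrite divr_ge0 // -(avg_cst m 0 L_gt0); apply: le_avg.
Qed.

Lemma avg_sum m s (r : seq nat) (P : pred nat) (F : nat -> seq nat -> R) :
  avg m s (fun w => \sum_(k <- r | P k) F k w) = \sum_(k <- r | P k) avg m s (F k).
Proof. by rewrite /avg /sumw exchange_big /= mulr_suml. Qed.

Lemma density_sum_cvg r (P : pred nat) :
  avg m 0 (fun w => \sum_(k <- r | P k) (gaps k w)%:R) / m%:R @[m --> \oo]
  --> \sum_(k <- r | P k) a k.
Proof.
under eq_fun do rewrite avg_sum mulr_suml.
by apply: cvg_big => [|k _]; [exact: add_continuous | exact: a_avg].
Qed.

(** Passing to the limit in [gaps_tail]. *)
Lemma density_tail K M (P : pred nat) : (0 < K)%N ->
  \sum_(K <= k < M | P k) a k <= K%:R^-1.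
Proof.
move=> K0; apply: (cvgr_to_le (@density_sum_cvg (index_iota K M) P)).
near=> m; have m0 : 0 < m%:R :> R.
  by rewrite ltr0n; near: m; exact: nbhs_infty_gt.
rewrite ler_pdivrMr // -(avg_cst m (_^-1 * _) L_gt0).
apply: (le_avg L_gt0) => w; rewrite mem_words => /andP[/eqP sw _].
rewrite mulrC ler_pdivlMr ?ltr0n // -natr_sum -natrM ler_nat mulnC -[leqRHS]sw.
exact: gaps_tail.
Unshelve. all: by end_near. Qed.

Definition gap_density (P : pred nat) := lim (\sum_(0 <= k < m | P k) a k @[m --> \oo]).

Lemma gap_density_mono (P : pred nat) :
  nondecreasing_seq (fun m => \sum_(0 <= k < m | P k) a k).
Proof.
move=> m n mn; rewrite [leRHS](big_cat_nat (n := m)) //= lerDl.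
by rewrite sumr_ge0 // => k _; exact: density_ge0.
Qed.

Lemma gap_density_cvg (P : pred nat) :
  \sum_(0 <= k < m | P k) a k @[m --> \oo] --> gap_density P.
Proof.
apply: nondecreasing_is_cvgn; first exact: gap_density_mono.
exists (a 0%N + 1) => _ [m _ <-].
apply: (@le_trans _ _ (\sum_(0 <= k < m.+1 | P k) a k)); first exact: gap_density_mono.
rewrite big_mkcond big_ltn //= lerD //; first by case: ifP => // _; exact: density_ge0.
rewrite -big_mkcond -[leRHS]invr1.
exact: density_tail.
Qed.

Lemma gap_density_close (P : pred nat) K : (0 < K)%N ->
  `|gap_density P - \sum_(0 <= k < K | P k) a k| <= K%:R^-1.
Proof.
move=> K0; set s := \sum_(_ <= _ < _ | _) _.
have lo : s <= gap_density P.
  exact: (nondecreasing_cvgn_le (@gap_density_mono P) (@gap_density_cvg P) K).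
have up : gap_density P <= s + K%:R^-1.
  apply: (cvgr_to_le (@gap_density_cvg P)); near=> m.
  rewrite (big_cat_nat (n := K)) //=; last by near: m; exact: nbhs_infty_ge.
  by rewrite lerD2l; exact: density_tail.
by rewrite ger0_norm; lra.
Unshelve. all: by end_near. Qed.

(* density of nonzero digits *)
(** From any state, among the words of length [L + 1] a proportion at least
    [1 / B] contains a nonzero digit: go to state 0 and read 1.  Hence each block
    of [L + 1] digits adds at least [1 / B] to the mean number of nonzero digits. *)
Lemma avg_nonzero_digits_ge : exists2 d : R, 0 < d & forall m,
  d * m%:R - 1 <= avg m 0 (fun w => (count (fun x => 0 < x)%N w)%:R).
Proof.
have [B B_gt0 B_le] := nwords_comparable (L + 1).
have BR : 0 < B%:R :> R by rewrite ltr0n.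
pose F (w : seq nat) : R := (count (fun x => 0 < x)%N w)%:R.
have key q l s : (s < L)%N -> q%:R / B%:R <= avg (q * (L + 1) + l) s F.
  elim: q s => [|q IHq] s sL.
    rewrite mul0r -(avg_cst (0 * (L + 1) + l) 0 sL).
    by apply: (le_avg sL).
  rewrite mulSn -addnA; set j := (q * (L + 1) + l)%N in IHq *.
  have hs : 0 < (nwords (L + 1 + j) s)%:R :> R by apply: nwordsR_gt0.
  rewrite /avg ler_pdivlMr // sumw_cat.
  have [p0 p0L p00] := path_to_zero sL.
  have pL : p0 ++ [:: 1%N] \in words (L + 1) s.
    move: p0L; rewrite !mem_words => /andP[/eqP sp rp].
    rewrite size_cat sp eqxx readable_cat rp p00 /= andbT.
    exact: (letter1_allowed).
  set p := p0 ++ _ in pL; have tL := state_words sL pL.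
  have Fcat p' : p' \in words (L + 1) s ->
      sumw j (state s p') (fun w => F (p' ++ w)) =
      (F p' + avg j (state s p') F) * (nwords j (state s p'))%:R.
    move=> p'L; have t'L := state_words sL p'L.
    rewrite mulrDl -sumw_cst -(sumw_avg) // /sumw -big_split.
    by apply: eq_bigr => w _; rewrite /F count_cat natrD.
  have weight : (nwords (L + 1 + j) s)%:R / B%:R <= (nwords j (state s p))%:R :> R.
    by rewrite ler_pdivrMr // -natrM ler_nat mulnC; apply: B_le.
  have Fp : 1 <= F p by rewrite ler1n count_cat /= addn1.
  apply: (@le_trans _ _ (q%:R / B%:R * (nwords (L + 1 + j) s)%:R +
                         (nwords j (state s p))%:R)).
    by rewrite -natr1 mulrDl mul1r mulrDl lerD2l mulrC.
  rewrite nwordsR_cat mulr_sumr !(big_rem p pL) /= addrAC; apply: lerD.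
    rewrite Fcat // -[X in _ + X]mul1r -mulrDl ler_wpM2r // addrC lerD //.
    exact: IHq.
  rewrite !big_seq; apply: ler_sum => p' /mem_rem p'L.
  rewrite Fcat // ler_wpM2r //; apply: le_trans (IHq _ (state_words sL p'L)) _.
  by rewrite lerDr.
have L1 : 0 < (L + 1)%:R :> R by rewrite ltr0n addn1.
exists (B%:R * (L + 1)%:R)^-1 => [|m]; first by rewrite invr_gt0 mulr_gt0.
have := key (m %/ (L + 1))%N (m %% (L + 1))%N 0%N L_gt0; rewrite -divn_eq.
apply: le_trans; rewrite lerBlDr.
have B1 : B%:R^-1 <= 1 :> R by rewrite invf_le1 // ler1n.
apply: (@le_trans _ _ ((m %/ (L + 1)).+1%:R / B%:R)); last first.
  by rewrite -natr1 mulrDl mul1r lerD2l.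
rewrite invfM -mulrA [leLHS]mulrC ler_wpM2r ?invr_ge0 //.
rewrite mulrC ler_pdivrMr //.
by rewrite -natrM ler_nat ltnW // ltn_ceil // addn1.
Qed.

Lemma gap_density_pos : 0 < gap_density xpredT.
Proof.
have [d d0 dP] := avg_nonzero_digits_ge.
(* dropping the lengths from [K] on costs at most [1 / K <= d / 4], and the two
   additive constants 1 cost at most [d / 4] as soon as [m >= 8 / d] *)
have [K [K0 Kd]] : exists K, (0 < K)%N /\ 4 / d <= K%:R.
  have : \forall K \near \oo, (0 < K)%N /\ 4 / d <= K%:R.
    near=> K; split; first by near: K; exact: nbhs_infty_gt.
    by near: K; exact: nbhs_infty_ger.
  by move=> /filter_ex[K KP]; exists K.
have KR : 0 < K%:R :> R by rewrite ltr0n.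
have Kd' : K%:R^-1 <= d / 4.
  by rewrite -[d / 4]invrK invf_div lef_pV2 ?posrE // divr_gt0.
apply: (@lt_le_trans _ _ (d / 2)); first by rewrite divr_gt0.
apply: (@le_trans _ _ (\sum_(0 <= k < K) a k)); last first.
  exact: (nondecreasing_cvgn_le (@gap_density_mono xpredT) (@gap_density_cvg xpredT) K).
apply: (cvgr_to_ge (@density_sum_cvg (index_iota 0 K) xpredT)); near=> m.
have m0 : 0 < m%:R :> R by rewrite ltr0n; near: m; exact: nbhs_infty_gt.
have Km : (K <= m.+1)%N by rewrite leqW //; near: m; exact: nbhs_infty_ge.
have md : 8 / d <= m%:R by near: m; exact: nbhs_infty_ger.
rewrite ler_pdivlMr //.
have count_le w : w \in words m 0 -> (count (fun x => 0 < x)%N w)%:R <=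
    \sum_(0 <= k < K) (gaps k w)%:R + m%:R / K%:R + 1 :> R.
  rewrite mem_words => /andP[/eqP sw _].
  have wm : (size w <= m)%N by rewrite sw.
  apply: (@le_trans _ _ (\sum_(0 <= k < m.+1) (gaps k w)%:R + 1)).
    rewrite -natr_sum natr1 ler_nat.
    apply: leq_trans (count_pos_le_gaps max_letter wm) _.
    by rewrite ltnS [leqRHS]big_ltn // leq_addl.
  rewrite (big_cat_nat (n := K)) //= -addrA -[leRHS]addrA lerD2l lerD2r.
  rewrite ler_pdivlMr // mulrC -natr_sum -natrM ler_nat -[leqRHS]sw.
  exact: gaps_tail.
have := le_trans (dP m) (le_avg L_gt0 count_le).
rewrite !avgD !avg_cst // => h.
have h1 : m%:R / K%:R <= d / 4 * m%:R by rewrite mulrC ler_wpM2r // ltW.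
have h2 : 2 <= d / 4 * m%:R.
  have := ler_wpM2l (ltW d0) md; rewrite mulrCA mulfV ?gt_eqF //; lra.
lra.
Unshelve. all: by end_near. Qed.

(** Only finitely many lengths matter up to a given error, uniformly in the word,
    so the sum over an infinite set of lengths may be exchanged with the limit. *)
Lemma EQ_cvg_gaps (P : pred nat) :
  EQ_cvg (fun n N => (\sum_(0 <= k < n.+1 | P k) gap_count n k (digit L c N))%:R
                      / n.+1%:R) (gap_density P).
Proof.
apply: EQ_cvg_approx => // e e0.
have [K [K0 Ke]] : exists K, (0 < K)%N /\ K%:R^-1 <= e.
  have : \forall K \near \oo, (0 < K)%N /\ K%:R^-1 <= e.
    near=> K; have K0 : (0 < K)%N by near: K; exact: nbhs_infty_gt.
    split=> //; rewrite -[leRHS]invrK lef_pV2 ?posrE ?invr_gt0 ?ltr0n // ltW //.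
    by near: K; exact: nbhs_infty_gtr.
  by move=> /filter_ex[K KP]; exists K.
exists (fun n N => \sum_(0 <= k < K | P k) ((gaps k (decomp L c N))%:R / n.+1%:R)).
exists (\sum_(0 <= k < K | P k) a k); split.
- by apply: EQ_cvg_sum => // k _; exact: a_EQ.
- by apply: le_trans Ke; exact: gap_density_close.
near=> n => N nN.
have Kn : (K <= n.+1)%N by rewrite leqW //; near: n; exact: nbhs_infty_ge.
under eq_bigr do rewrite (gap_count_decomp _ nN).
rewrite (big_cat_nat (n := K)) //= natrD -mulr_suml -natr_sum mulrDl addrAC subrr add0r.
rewrite ger0_norm ?divr_ge0 // (le_trans _ Ke) // ler_pdivrMr ?ltr0n //.
rewrite mulrC ler_pdivlMr ?ltr0n // -natrM ler_nat mulnC.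
have := Qrange_words nN; rewrite mem_words => /andP[/eqP <- _].
exact: gaps_tail.
Unshelve. all: by end_near. Qed.

Lemma EQ_cvg_gap_total :
  EQ_cvg (fun n N => (gap_total n (digit L c N))%:R / n.+1%:R) (gap_density xpredT).
Proof. exact: EQ_cvg_gaps. Qed.

Lemma EQ_cvg_gap_count k :
  EQ_cvg (fun n N => (gap_count n k (digit L c N))%:R / n.+1%:R) (a k).
Proof.
apply: EQ_cvg_approx => // e e0.
exists (fun n N => (gaps k (decomp L c N))%:R / n.+1%:R), (a k); split.
- exact: a_EQ.
- by rewrite subrr normr0 ltW.
- near=> n => N nN.
  by rewrite (gap_count_decomp k nN) subrr normr0 ltW.
Unshelve. all: by end_near. Qed.

(** * The empirical gap distribution *)

Lemma mu_infty1E k : mu_infty1 R L c k = a k / gap_density xpredT.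
Proof.
apply: cvg_lim => //.
have h1 := EQ_cvg_mean (EQ_cvg_gap_count k).
have h2 := EQ_cvg_mean EQ_cvg_gap_total.
apply: cvg_trans (cvgM h1 (cvgV (lt0r_neq0 gap_density_pos) h2)).
apply: near_eq_cvg; near=> n => /=.
have scale f : EQ n (fun N => f N / n.+1%:R) = EQ n f / n.+1%:R.
  by rewrite /Defs.EQ -mulr_suml mulrAC.
by rewrite !scale invf_div mulrA divfK // pnatr_eq0.
Unshelve. all: by end_near. Qed.

Lemma mu_inftyE A :
  mu_infty R L c A = gap_density (fun k => k \in A) / gap_density xpredT.
Proof.
apply: cvg_lim => //.
rewrite (_ : (fun m => _) =
    fun m => (\sum_(0 <= k < m | k \in A) a k) / gap_density xpredT).
  by apply: cvgMl; exact: (gap_density_cvg).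
apply/funext => m; rewrite mulr_suml.
by apply: eq_bigr => k _; rewrite mu_infty1E.
Qed.

(** Let [h] be the empirical frequency, [s] and [T] the numbers of gaps in [A] and
    in all, [x = n + 1], and [aA], [t] the limits of [s / x] and [T / x].  As
    [h * T = s], even when [T = 0],
    [h - aA / t = ((s / x - aA) - h * (T / x - t)) / t], and [0 <= h <= 1]. *)
Lemma EQ_cvg_hat_mu A :
  EQ_cvg (fun n N => hat_mu R n (digit L c N) A) (mu_infty R L c A).
Proof.
have hA := EQ_cvg_gaps (fun k => k \in A).
have hT := EQ_cvg_gap_total.
rewrite mu_inftyE; move: (gap_density xpredT) gap_density_pos hA hT => t t0.
move: (gap_density _) => aA hA hT.
apply: (@squeeze_cvgr _ _ _ _ (fun=> 0) (fun n => t^-1 *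
  (EQ n (fun N => `|(\sum_(0 <= k < n.+1 | k \in A) gap_count n k (digit L c N))%N%:R
                      / n.+1%:R - aA|) +
   EQ n (fun N => `|(gap_total n (digit L c N))%:R / n.+1%:R - t|)))).
- near=> n; apply/andP; split.
    by rewrite -(EQ_cst n 0); apply: le_EQ.
  rewrite -EQD -EQZ; apply: le_EQ => N _; rewrite /hat_mu.
  set X := digit L c N; set s := (\sum_(_ <= _ < _ | _) _)%N.
  have sT : (s <= gap_total n X)%N.
    by rewrite /s big_mkcond; apply: leq_sum => k _; case: ifP.
  set h : R := s%:R / _.
  have h01 : 0 <= h <= 1.
    rewrite divr_ge0 //= ler_pdivrMr ?ltr0n ?leq_max ?orbT // mul1r ler_nat.
    by rewrite leq_max sT.
  have hs : h * (gap_total n X)%:R = s%:R.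
    rewrite /h; have [T0|T0] := posnP (gap_total n X).
      by move: sT; rewrite T0 leqn0 => /eqP ->; rewrite mulr0.
    by rewrite (maxn_idPl T0) divfK // pnatr_eq0 -lt0n.
  have n0 : n.+1%:R != 0 :> R by rewrite pnatr_eq0.
  have -> : h - aA / t = t^-1 * ((s%:R / n.+1%:R - aA) -
                                 h * ((gap_total n X)%:R / n.+1%:R - t)).
    rewrite -hs; move: (n.+1%:R : R) n0 => x x0; field.
    by rewrite x0 gt_eqF.
  rewrite normrM gtr0_norm ?invr_gt0 // ler_wpM2l ?invr_ge0 ?(ltW t0) //.
  apply: le_trans (ler_normB _ _) _; rewrite lerD2l normrM.
  by case/andP: h01 => h0 h1; rewrite ler_piMl // ger0_norm.
- exact: cvg_cst.
- rewrite (_ : 0 = t^-1 * (0 + 0)); last by rewrite addr0 mulr0.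
  by apply: cvgMr; apply: cvgD.
Unshelve. all: by end_near. Qed.

End Densities.
End PositiveLinearRecursion.

Theorem theorem4p2 (R : realType) (L : nat) (c : nat -> nat)
    (L_gt0 : (0 < L)%N) (c_gt0 : (0 < c 1%N * c L)%N)
    (Lc_neq : (L, c 1%N) <> (1%N, 1%N))
    (A : set nat) (eps : R) (eps_gt0 : 0 < eps) :
  Q R L c n (fun N => `|hat_mu R n (digit L c N) A - mu_infty R L c A| > eps)
    @[n --> \oo] --> (0 : R).
Proof.
move: c_gt0; rewrite muln_gt0 => /andP[c1_gt0 cL_gt0].
have [a a_lim] := choice (gap_law L_gt0 c1_gt0 cL_gt0 R Lc_neq).
apply: EQ_cvg_prob => //; apply: (EQ_cvg_hat_mu _ _ _ _ (a := a)) => // k.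
  exact: (a_lim k).1.
exact: (a_lim k).2.
Qed.
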